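(* Let $\epsilon>0$, let $0<c<1$, and let $$\Omega=\{(x,t)\in\mathbb{R}^n\times(-\infty,0):\ -c<t<0,\ |x|^2<-4(1+\epsilon)t\log|\log|t||\,\}$$ be the domain bounded by $|x|^2=-4(1+\epsilon)t\log|\log|t||$ and $t=-c$. Then the origin $(x,t)=(0,0)$ is not a regular boundary point of $\Omega$ for the normalised $\infty$-heat equation $u_t-\Delta_\infty^N u=0$.
   Context: Let $\Omega\subset\mathbb{R}^n\times\mathbb{R}$ be a bounded domain. Points are written $\zeta=(x,t)$; $D$ and $D^2$ are the gradient and Hessian in the spatial variable $x$ only; $\partial\Omega$ is the Euclidean boundary in $\mathbb{R}^{n+1}$. For $D\psi\ne0$, $\Delta_\infty^N\psi=\frac{1}{|D\psi|^2}\sum_{i,j=1}^n\psi_{x_i}\psi_{x_j}\psi_{x_ix_j}$. For a symmetric matrix $X$, $\Lambda(X)$ is its largest eigenvalue. An upper semicontinuous $u:\Omega\to\mathbb{R}\cup\{-\infty\}$ is a (viscosity) subsolution in $\Omega$ if for every $\psi\in C^2(\Omega)$ such that $u-\psi$ has a maximum at $\zeta_0\in\Omega$ one has $\psi_t(\zeta_0)-\Delta_\infty^N\psi(\zeta_0)\le0$ if $D\psi(\zeta_0)\neq0$, and $\psi_t(\zeta_0)-\Lambda(D^2\psi(\zeta_0))\le0$ if $D\psi(\zeta_0)=0$. Lower Perron solution: for $f:\partial\Omega\to\mathbb{R}$ continuous, the lower class $\mathcal{L}_f$ consists of all subsolutions $v$ in $\Omega$ with $\limsup_{\eta\to\zeta,\,\eta\in\Omega}v(\eta)\le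 f(\zeta)$ for all $\zeta\in\partial\Omega$, and $\underline{H}_f(\zeta)=\sup\{v(\zeta):v\in\mathcal{L}_f\}$ for $\zeta\in\Omega$. Regular point: $\zeta_0\in\partial\Omega$ is a regular boundary point of $\Omega$ if $\lim_{\zeta\to\zeta_0,\,\zeta\in\Omega}\underline{H}_f(\zeta)=f(\zeta_0)$ for every continuous $f:\partial\Omega\to\mathbb{R}$. *)

(* Defs.v *)
From HB Require Import structures.
From mathcomp Require Import all_boot all_order all_algebra.
From mathcomp Require Import all_classical all_reals all_analysis.

Set Implicit Arguments.
Unset Strict Implicit.
Unset Printing Implicit Defensive.

Import Order.TTheory GRing.Theory Num.Theory.
Import numFieldNormedType.Exports.

Local Open Scope classical_set_scope.
Local Open Scope ring_scope.

Definition boundary (T : topologicalType) (A : set T) : set T :=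
  closure A `\` interior A.

(* Space-time points (x, t). The norms of the library on row vectors and on
   products are sup norms, so they give the Euclidean topology; |.|^2 in the
   definitions below is always written as a sum of squares. *)
Notation spacetime R n := ('rV[R]_n * R)%type.

Section NormalisedInfinityHeat.
Context {R : realType} {n : nat}.
Implicit Types (Omega : set (spacetime R n)) (psi f : spacetime R n -> R).
Implicit Types (u v : spacetime R n -> \bar R) (z : spacetime R n).

Definition sqnorm (x : 'rV[R]_n) : R := \sum_(i < n) x 0 i ^+ 2.

(* Some i is the direction x_i, None is the direction t. *)
Definition coord_dir (k : option 'I_n) : spacetime R n :=
  if k is Some i then (delta_mx 0 i, 0) else (0, 1).

Definition pderiv (k : option 'I_n) psi : spacetime R n -> R :=
  'D_(coord_dir k) psi.

(* For open Omega: all partial derivatives of order at most two, in x and t,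
   exist and are continuous in Omega. Values off Omega are irrelevant. *)
Definition C2_on Omega psi : Prop :=
  forall z, Omega z ->
    {for z, continuous psi} /\
    (forall k, derivable psi z (coord_dir k) /\
               {for z, continuous (pderiv k psi)}) /\
    (forall k l, derivable (pderiv k psi) z (coord_dir l) /\
                 {for z, continuous (pderiv l (pderiv k psi))}).

Definition time_deriv psi z : R := pderiv None psi z.

Definition gradx psi z : 'rV[R]_n := \row_i pderiv (Some i) psi z.

Definition hessx psi z : 'M[R]_n :=
  \matrix_(i, j) pderiv (Some j) (pderiv (Some i) psi) z.

(* The eigenvalues of a symmetric matrix of size n > 0 form a finite nonempty
   set of reals, so that this supremum is a maximum. *)
Definition largest_eigenvalue (X : 'M[R]_n) : R :=
  sup [set a : R | eigenvalue X a].

Definition norm_infty_laplacian psi z : R :=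
  (sqnorm (gradx psi z))^-1 *
  \sum_(i < n) \sum_(j < n)
    gradx psi z 0 i * gradx psi z 0 j * hessx psi z i j.

Definition upper_semicontinuous_on Omega u : Prop :=
  forall z, Omega z -> forall a : R, (u z < a%:E)%E ->
    \forall y \near within Omega (nbhs z), (u y < a%:E)%E.

Definition max_on_at Omega (g : spacetime R n -> \bar R) z0 : Prop :=
  Omega z0 /\ forall z, Omega z -> (g z <= g z0)%E.

(* Functions on Omega are represented by functions on the whole space, of which
   only the values in Omega matter. *)
Definition subsolution Omega u : Prop :=
  [/\ forall z, Omega z -> u z != +oo%E,
      upper_semicontinuous_on Omega u &
      forall psi z0, C2_on Omega psi ->
        max_on_at Omega (fun z => u z - (psi z)%:E)%E z0 ->
        (gradx psi z0 != 0 ->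
           time_deriv psi z0 - norm_infty_laplacian psi z0 <= 0) /\
        (gradx psi z0 = 0 ->
           time_deriv psi z0 - largest_eigenvalue (hessx psi z0) <= 0)].

Definition lower_class Omega f : set (spacetime R n -> \bar R) :=
  [set v | subsolution Omega v /\
     forall z, boundary Omega z ->
       (limf_esup v (within Omega (nbhs z)) <= (f z)%:E)%E].

Definition lower_perron Omega f z : \bar R :=
  ereal_sup [set v z | v in lower_class Omega f].

Definition regular_boundary_point Omega z0 : Prop :=
  boundary Omega z0 /\
  forall f, {within boundary Omega, continuous f} ->
    lower_perron Omega f z @[z --> within Omega (nbhs z0)] --> (f z0)%:E.

Definition petrovsky_domain (eps c : R) : set (spacetime R n) :=
  [set z | - c < z.2 < 0 /\
     sqnorm z.1 < - 4 * (1 + eps) * z.2 * ln `| ln `|z.2| | ].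

End NormalisedInfinityHeat.

(* Main.v *)
(** With [L = - ln (- t)], [d = eps / 2] and [a = (1 + d) / (4 (1 + eps)) < 1/4],
    the function
      [W = 1 - L^-(1+d) exp (a |x|^2 / -t) + (C / d) L^-d]
    is a subsolution for suitable [C]: it is radially decreasing in [x], so the
    normalised infinity-Laplacian is its second radial derivative and the
    equation reduces to a one-dimensional heat inequality. On the lateral
    boundary [W] equals [(C / d) L^-d], which tends to [0] at the origin,
    whereas [W (0, t)] tends to [1]. Since the equation only looks into the
    past, [W] for [t <= - tau], continued by [-oo] for later times, is still a
    subsolution. For [M] large these truncations all lie in the lower class of
    the data [1/2 - M t], so the lower Perron solution is at least [3/4] at
    points [(0, - tau)] arbitrarily close to the origin, where the data
    equals [1/2]. *)
Require Import Defs.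
From mathcomp Require Import all_boot all_order all_algebra.
From mathcomp Require Import all_classical all_reals all_analysis.
From mathcomp Require Import complex.
From mathcomp Require Import ring lra.
Set Implicit Arguments.
Unset Strict Implicit.
Unset Printing Implicit Defensive.
Import Order.TTheory GRing.Theory Num.Theory.
Import numFieldNormedType.Exports.
Local Open Scope classical_set_scope.
Local Open Scope ring_scope.

(** * Directional derivatives, mean values along lines, and one-variable tests at a maximum *)

Lemma is_derive_of_cvg {R : numFieldType} {V W : normedModType R}
    (g : V -> W) (z v : V) (d : W) :
  h^-1 *: (g (h *: v + z) - g z) @[h --> 0^'] --> d -> is_derive z v g d.
Proof.
by move=> gd; split; [apply/cvg_ex; exists d|apply: cvg_lim].
Qed.

Lemma cvg_of_is_derive {R : numFieldType} {V W : normedModType R}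
    (g : V -> W) (z v : V) (d : W) :
  is_derive z v g d -> h^-1 *: (g (h *: v + z) - g z) @[h --> 0^'] --> d.
Proof. by case=> gd <-. Qed.

Lemma is_derive_line {R : numFieldType} {V W : normedModType R}
    (g : V -> W) (z v : V) (k : R) (d : W) :
  is_derive (k *: v + z) v g d -> is_derive k 1 (fun h => g (h *: v + z)) d.
Proof.
move=> /cvg_of_is_derive gd; apply: is_derive_of_cvg.
apply: cvg_trans gd; apply: near_eq_cvg.
by apply: nearW => h; rewrite [_%:A]mulr1 scalerDl addrA.
Qed.

(** The sign of [k] is free, hence the bounds in absolute value: difference quotients are taken on
    both sides of [0]. *)
Lemma direction_MVT {R : realType} {V : normedModType R} (g : V -> R)
    (z u : V) (k : R) :
  (forall s : R, `|s| <= `|k| -> derivable g (s *: u + z) u) ->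
  exists2 s, `|s| <= `|k| &
    g (k *: u + z) - g z = k * 'D_u g (s *: u + z).
Proof.
move=> dg; pose F h := g (h *: u + z).
have dF (s : R) : `|s| <= `|k| ->
    is_derive (s : R) (1 : R) F ('D_u g (s *: u + z)).
  by move=> /dg /derivableP; exact: is_derive_line.
have F0 : F 0 = g z by rewrite /F scale0r add0r.
have cF (a b : R) : (forall s, s \in `[a, b] -> `|s| <= `|k|) ->
    {within `[a, b], continuous F}.
  move=> ab; apply: derivable_within_continuous => s /ab /dF.
  by case.
case: (lerP 0 k) => k0.
  have sk s : s \in `[0, k] -> `|s| <= `|k|.
    by rewrite in_itv/= => /andP[s0 sk]; rewrite !ger0_norm.
  have [s sI] := MVT_segment k0
    (fun s sI => dF s (sk s (subset_itv_oo_cc sI))) (cF _ _ sk).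
  by rewrite subr0 F0 mulrC => Fk; exists s; [exact: sk|].
have sk s : s \in `[k, 0] -> `|s| <= `|k|.
  rewrite in_itv/= => /andP[ks s0]; rewrite !ler0_norm ?lerN2//.
  exact: ltW.
have [s sI] := MVT_segment (ltW k0)
  (fun s sI => dF s (sk s (subset_itv_oo_cc sI))) (cF _ _ sk).
rewrite sub0r F0 => Fk; exists s; first exact: sk.
by rewrite -opprB Fk mulrN opprK mulrC.
Qed.

Lemma near0_mul_lt {R : realFieldType} (K e : R) : 0 < e ->
  \forall h \near (0 : R), `|h| * K < e.
Proof.
move=> e0; have K1 : 0 < `|K| + 1 by rewrite ltr_wpDl.
near=> h; apply: (@le_lt_trans _ _ (`|h| * (`|K| + 1))).
  by rewrite ler_wpM2l// (le_trans (ler_norm _))// lerDl.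
rewrite -ltr_pdivlMr//; near: h; apply/nbhs_normP.
exists (e / (`|K| + 1)); first by rewrite /= divr_gt0.
by move=> h /=; rewrite sub0r normrN.
Unshelve. all: by end_near. Qed.

Lemma near_norm {R : realFieldType} {V : normedModType R} (z : V) (P : set V) :
  (\forall y \near z, P y) ->
  exists2 e : R, 0 < e & forall y, `|y| < e -> P (y + z).
Proof.
move=> /nbhs_normP[e /= e0 eP]; exists e => // y ye.
by apply: eP => /=; rewrite opprD addrCA subrr addr0 normrN.
Qed.

(** The increment along [c *: u + w] splits into a step along [w], governed by the hypothesis at
    [z], and a step along [u] from a moving base point, governed by the mean value theorem and
    continuity of ['D_u g]. Adding directions one at a time gives linearity in the direction from
    continuous partial derivatives alone. *)
Lemma is_derive_dir_add {R : realType} {V : normedModType R} (g : V -> R)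
    (z w u : V) (c dw : R) :
  is_derive z w g dw -> (\forall y \near z, derivable g y u) ->
  {for z, continuous ('D_u g)} ->
  is_derive z (c *: u + w) g (c * 'D_u g z + dw).
Proof.
move=> /cvg_of_is_derive gw /near_norm[d d0 dg] cu.
apply: is_derive_of_cvg.
have small (e : R) : 0 < e -> \forall h \near (0 : R),
    `|h| * (`|w| + `|c| * `|u|) < e by exact: near0_mul_lt.
have bound (h s e : R) : `|h| * (`|w| + `|c| * `|u|) < e ->
    `|s| <= `|h * c| -> `|s *: u + h *: w| < e.
  move=> he sh; apply: le_lt_trans he; apply: (le_trans (ler_normD _ _)).
  rewrite !normrZ mulrDr addrC lerD2l mulrA -normrM.
  by rewrite ler_wpM2r.
have cF : h^-1 * (g ((h * c) *: u + (h *: w + z)) - g (h *: w + z))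
    @[h --> 0^'] --> c * 'D_u g z.
  apply/cvgrPdist_le => e e0.
  have e1 : 0 < e / (`|c| + 1) by rewrite divr_gt0// ltr_wpDl.
  move/cvgrPdist_le : cu => /(_ _ e1) /near_norm[d' d'0 cu].
  near=> h.
  have h0 : h != 0 by near: h; exact: nbhs_dnbhs_neq.
  have [s sh ->] : exists2 s, `|s| <= `|h * c| &
      g ((h * c) *: u + (h *: w + z)) - g (h *: w + z) =
      (h * c) * 'D_u g (s *: u + (h *: w + z)).
    apply: direction_MVT => s sh; rewrite addrA; apply: dg.
    apply: bound sh; near: h; apply: nbhs_dnbhs; exact: small.
  rewrite -!mulrA mulKf// -mulrBr normrM addrA.
  apply: (@le_trans _ _ (`|c| * (e / (`|c| + 1)))).
    rewrite ler_wpM2l//; apply: cu; apply: bound sh.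
    by near: h; apply: nbhs_dnbhs; exact: small.
  rewrite mulrCA ler_piMr ?ltW//.
  by rewrite ltr_pdivrMr ?mul1r ?ltrDl// ltr_wpDl.
apply: cvg_trans (cvgD cF gw); apply: near_eq_cvg.
near=> h.
transitivity (h^-1 * (g ((h * c) *: u + (h *: w + z)) - g (h *: w + z)) +
  h^-1 * (g (h *: w + z) - g z)) => //.
rewrite -mulrDr addrA subrK; congr (_ * (g _ - _)).
by rewrite scalerDr scalerA addrA.
Unshelve. all: by end_near. Qed.

(** Quotients with [h < 0] are nonnegative. The one-sided form is what a comparison restricted to
    the past provides for the time derivative. *)
Lemma is_derive_left_max_ge0 {R : realType} (f : R -> R) (m : R) :
  is_derive (0 : R) (1 : R) f m ->
  (\forall h \near (0 : R), h < 0 -> f h <= f 0) -> 0 <= m.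
Proof.
move=> /cvg_of_is_derive /cvg_dnbhs_at_left fm mx.
have mx' : \forall h \near 0^'-, h < 0 -> f h <= f 0 by exact: cvg_within mx.
apply: cvgr_to_ge fm _; near=> h.
have h0 : h < 0 by near: h; exact: nbhs_left_lt.
rewrite -[_ *: _]/(_ * _) [_%:A]mulr1 addr0 mulr_le0//.
  by rewrite invr_le0 ltW.
by rewrite subr_le0 (near mx' h).
Unshelve. all: by end_near. Qed.

Lemma is_derive_comp_opp {R : realType} (f : R -> R) (x m : R) :
  is_derive (- x) (1 : R) f m -> is_derive x (1 : R) (fun h => f (- h)) (- m).
Proof.
by move=> fm; rewrite -mulrN1; apply: is_derive1_comp.
Qed.

Lemma second_derivative_test {R : realType} (f df : R -> R) (m : R) :
  (\forall h \near (0 : R), is_derive h (1 : R) f (df h)) ->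
  is_derive (0 : R) (1 : R) df m ->
  (\forall h \near (0 : R), f h <= f 0) -> df 0 = 0 /\ m <= 0.
Proof.
move=> fd dfm mx; have f0 := nbhs_singleton fd.
have df0 : df 0 = 0.
  apply/eqP; rewrite eq_le; apply/andP; split; last first.
    by apply: (is_derive_left_max_ge0 f0); apply: filterS mx.
  rewrite -oppr_ge0; apply: (@is_derive_left_max_ge0 _ (fun h => f (- h))).
    by apply: is_derive_comp_opp; rewrite oppr0.
  rewrite oppr0; have cN : (- h : R) @[h --> (0 : R)] --> (0 : R).
    by rewrite -{2}oppr0; exact: opp_continuous.
  have mxN : \forall h \near (0 : R), f (- h) <= f 0 := cN _ mx.
  apply: filterS mxN => h /= fh _.
  exact: fh.
split=> //; rewrite leNgt; apply/negP => m0.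
have := cvg_of_is_derive dfm.
move=> /cvgr_gt -/(_ _ m0); rewrite -nbhs_nearE => /nbhs_normP[e /= e0 eP].
move/near_norm : fd => [e1 e10 fd]; move/near_norm : mx => [e2 e20 mx].
pose k := Num.min e (Num.min e1 e2) / 2.
have k0 : 0 < k by rewrite divr_gt0// !lt_min e0 e10.
have : k < Num.min e (Num.min e1 e2).
  by rewrite /k ltr_pdivrMr// ltr_pMr ?ltr1n// !lt_min e0 e10.
rewrite !lt_min => /and3P[ke ke1 ke2].
have fd' x : x \in `]0, k[ -> is_derive x 1 f (df x).
  rewrite in_itv/= => /andP[x0 xk].
  by have := fd x; rewrite addr0; apply; rewrite gtr0_norm// (lt_trans xk).
have [|c ck fk] := MVT k0 fd'.
  apply: derivable_within_continuous => x; rewrite in_itv/= => /andP[x0 xk].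
  have := fd x; rewrite addr0; case=> //.
  by rewrite ger0_norm// (le_lt_trans xk).
have := mx k; rewrite addr0 gtr0_norm// => /(_ ke2).
rewrite -subr_le0 fk subr0 pmulr_lle0// leNgt.
move: ck; rewrite in_itv/= => /andP[c0 ck].
have := eP c; rewrite /= sub0r normrN gtr0_norm// df0 subr0 addr0.
move=> /(_ (lt_trans ck ke) (lt0r_neq0 c0)).
by rewrite -[_ *: _]/(_ * _) [_%:A]mulr1 pmulr_rgt0 ?invr_gt0// => ->.
Qed.

(** * Symmetry of mixed second derivatives, and a real eigenvalue of a symmetric matrix *)

Lemma is_derive_shiftr {R : numFieldType} {V W : normedModType R}
    (g : V -> W) (a z v : V) (d : W) :
  is_derive (a + z) v g d -> is_derive z v (fun y => g (a + y)) d.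
Proof.
move=> /cvg_of_is_derive gd; apply: is_derive_of_cvg.
apply: cvg_trans gd; apply: near_eq_cvg; apply: nearW => h.
by rewrite addrCA.
Qed.

(** The mean value theorem is used twice: along [u] for the difference [G] of two translates of [g],
    then along [w] for ['D_u g]. *)
Lemma double_difference {R : realType} {V : normedModType R} (g : V -> R)
    (z u w : V) (h : R) :
  (forall y, `|y| <= `|h| * (`|u| + `|w|) -> derivable g (y + z) u /\
     derivable ('D_u g) (y + z) w) ->
  exists2 y, `|y| <= `|h| * (`|u| + `|w|) &
    (g (h *: u + (h *: w + z)) - g (h *: w + z)) - (g (h *: u + z) - g z) =
    h * (h * 'D_w ('D_u g) (y + z)).
Proof.
move=> dg; pose G y := g (h *: w + y) - g y.
have bd (s t : R) : `|s| <= `|h| -> `|t| <= `|h| ->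
    `|t *: w + s *: u| <= `|h| * (`|u| + `|w|).
  move=> sh th; apply: (le_trans (ler_normD _ _)).
  by rewrite !normrZ mulrDr addrC lerD// ler_wpM2r.
have bd0 (s : R) : `|s| <= `|h| -> `|s *: u| <= `|h| * (`|u| + `|w|).
  by move=> /bd -/(_ 0); rewrite scale0r add0r normr0; apply.
have dG (s : R) : `|s| <= `|h| ->
    is_derive (s *: u + z) u G
      ('D_u g (h *: w + (s *: u + z)) - 'D_u g (s *: u + z)).
  move=> sh; apply: is_deriveB.
    apply: is_derive_shiftr; apply: derivableP; rewrite addrA.
    exact: (dg _ (bd _ _ sh (lexx _))).1.
  apply: derivableP; exact: (dg _ (bd0 _ sh)).1.
have [s sh] : exists2 s, `|s| <= `|h| &
    G (h *: u + z) - G z = h * 'D_u G (s *: u + z).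
  by apply: (@direction_MVT _ _ G z u h) => s /dG [].
have [_ ->] := dG s sh.
have [t th ->] : exists2 t, `|t| <= `|h| &
    'D_u g (h *: w + (s *: u + z)) - 'D_u g (s *: u + z) =
    h * 'D_w ('D_u g) (t *: w + (s *: u + z)).
  apply: (@direction_MVT _ _ ('D_u g) (s *: u + z) w h) => t th; rewrite addrA.
  exact: (dg _ (bd _ _ sh th)).2.
rewrite addrA => GE; exists (t *: w + s *: u); first exact: bd.
rewrite -GE /G addrCA (addrCA (h *: w)); ring.
Qed.

(** The double difference is symmetric in [u] and [w], so the two mixed derivatives agree at two
    points arbitrarily close to [z]; continuity moves both to [z]. This makes the Hessian of a test
    function symmetric. *)
Lemma schwarz {R : realType} {V : normedModType R} (g : V -> R) (z u w : V) :
  (\forall y \near z, [/\ derivable g y u, derivable g y w,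
     derivable ('D_u g) y w & derivable ('D_w g) y u]) ->
  {for z, continuous ('D_w ('D_u g))} ->
  {for z, continuous ('D_u ('D_w g))} ->
  'D_w ('D_u g) z = 'D_u ('D_w g) z.
Proof.
move=> /near_norm[d d0 dg] cwu cuw; apply/eqP; rewrite -subr_eq0 -normr_le0.
apply/ler_addgt0Pr => e e0; rewrite add0r.
have tri (p q r : R) : `|p - r| <= e / 2 -> `|q - r| <= e / 2 -> `|p - q| <= e.
  move=> pr qr; have -> : p - q = (p - r) - (q - r) by ring.
  by rewrite (le_trans (ler_normB _ _))// (le_trans (lerD pr qr))// -splitr.
have e2 : 0 < e / 2 by rewrite divr_gt0.
move/cvgrPdist_le : cwu => /(_ _ e2) /near_norm[d1 d10 cwu].
move/cvgrPdist_le : cuw => /(_ _ e2) /near_norm[d2 d20 cuw].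
have dd0 : 0 < Num.min d (Num.min d1 d2) by rewrite !lt_min d0 d10.
have := near0_mul_lt (`|u| + `|w|) dd0.
move=> /near_norm[k k0 /(_ (k / 2))].
have k20 : 0 < k / 2 by rewrite divr_gt0.
rewrite addr0 {1}(gtr0_norm k20) ltr_pdivrMr// ltr_pMr// ltr1n.
move=> /(_ isT); set h := k / 2; rewrite !lt_min => /and3P[hd hd1 hd2].
have [|y yh E1] := @double_difference _ _ g z u w h.
  move=> y yh; have [gu _ gw _] := dg y (le_lt_trans yh hd).
  exact: conj gu gw.
have [|y' y'h E2] := @double_difference _ _ g z w u h.
  move=> y'; rewrite (addrC `|w|) => y'h.
  have [_ gw _ gu] := dg y' (le_lt_trans y'h hd); exact: conj gw gu.
have h0 : h != 0 by rewrite gt_eqF.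
have key (p q : R) : h * (h * p) = h * (h * q) -> p = q.
  by move=> /(mulfI h0) /(mulfI h0).
have swap (p q r s : R) : p - q - (r - s) = p - r - (q - s) by ring.
have hC : h *: u + (h *: w + z) = h *: w + (h *: u + z) by rewrite addrCA.
have E : 'D_w ('D_u g) (y + z) = 'D_u ('D_w g) (y' + z).
  apply: key; move: ('D_w ('D_u g) (y + z)) ('D_u ('D_w g) (y' + z)) E1 E2.
  move=> p q; rewrite hC swap => E1 E2.
  exact: etrans (esym E1) E2.
move: y'h; rewrite (addrC `|w|) => y'h.
have := cuw y' (le_lt_trans y'h hd2).
have := cwu y (le_lt_trans yh hd1).
rewrite -E => pr qr; exact: tri pr qr.
Qed.

(** Some complex eigenvalue [a] exists, with eigenvector [v]. With [w] the conjugate transpose of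
    [v], [q = v w] is a nonzero real and [a q = v X w] equals its own conjugate, so [a] is real. *)
Lemma symmetric_eigenvalue {R : rcfType} {n : nat} (X : 'M[R]_n) :
  (0 < n)%N -> X^T = X -> exists a, eigenvalue X a.
Proof.
move=> n0 XT; pose toC : {rmorphism R -> R[i]} := real_complex R.
have [a aX] := Theorem7' (map_mx toC X) n0.
suff [b ab] : exists b : R, a = toC b.
  by exists b; move: aX; rewrite ab eigenvalue_map.
have /eigenvalueP[v vX v0] := aX.
pose w : 'cV[R[i]]_n := (map_mx Num.conj v)^T.
pose q := (v *m w) 0 0.
have conjX : map_mx Num.conj (map_mx toC X) = map_mx toC X.
  apply/matrixP => i j; rewrite !mxE; apply/CrealP/complex_realP.
  by exists (X i j).
have q0 : q != 0.
  apply: contraNneq v0 => q0; apply/eqP/rowP => j; rewrite mxE.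
  move: q0; rewrite /q mxE => /eqP; rewrite psumr_eq0; last first.
    by move=> i _; rewrite !mxE mul_conjC_ge0.
  by move=> /allP /(_ j (mem_index_enum _)); rewrite !mxE mul_conjC_eq0 => /eqP.
have aq : a * q = (v *m map_mx toC X *m w) 0 0 by rewrite vX -scalemxAl mxE.
have qC : q^* = q.
  rewrite /q !mxE rmorph_sum; apply: eq_bigr => i _.
  by rewrite !mxE rmorphM/= conjCK mulrC.
have XcT : (map_mx toC X)^T = map_mx toC X.
  by apply/matrixP => i j; rewrite 3!mxE -[in RHS]XT mxE.
have conjE (M : 'M[R[i]]_1) : (M 0 0)^* = (map_mx Num.conj M)^T 0 0.
  by rewrite !mxE.
have conjw : (map_mx Num.conj w)^T = v.
  by apply/rowP => i; rewrite !mxE conjCK.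
have : (a * q)^* = a * q.
  by rewrite aq conjE !map_mxM conjX !trmx_mul XcT conjw mulmxA.
rewrite rmorphM/= qC => /(mulIf q0) /CrealP /complex_realP[b ->].
by exists b.
Qed.

(** * Space derivatives of test functions and the quadratic form of the Hessian *)

Section SpatialDerivatives.
Context {R : realType} {n : nat}.
Implicit Types (Omega : set (spacetime R n)) (g psi : spacetime R n -> R).
Implicit Types (z : spacetime R n) (w : 'rV[R]_n).

Lemma is_derive_space g z w :
  (forall i, \forall y \near z, derivable g y (coord_dir (Some i))) ->
  (forall i, {for z, continuous (pderiv (Some i) g)}) ->
  is_derive z ((w, 0) : spacetime R n) g
    (\sum_(i < n) w 0 i * pderiv (Some i) g z).
Proof.
move=> dg cg.
have dgs (r : seq 'I_n) :
    is_derive z (\sum_(i <- r) w 0 i *: @coord_dir R n (Some i)) g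
      (\sum_(i <- r) w 0 i * pderiv (Some i) g z).
  elim: r => [|i r ih]; first by rewrite !big_nil; exact: is_derive0.
  by rewrite !big_cons; exact: is_derive_dir_add ih (dg i) (cg i).
have -> : ((w, 0) : spacetime R n) = \sum_i w 0 i *: coord_dir (Some i).
  rewrite [in LHS](row_sum_delta w).
  elim/big_rec2 : _ => // i y1 y2 _ <-.
  by congr (_, _); rewrite /= scaler0 addr0.
exact: dgs.
Qed.

Lemma near_line Omega z (v : spacetime R n) : open Omega -> Omega z ->
  \forall h \near (0 : R), Omega (h *: v + z).
Proof.
move=> oO Oz; have /near_norm[e e0 eO] := open_nbhs_nbhs (conj oO Oz).
apply: filterS (near0_mul_lt `|v| e0) => h he.
by apply: eO; rewrite normrZ.
Qed.

Lemma C2_is_derive_space Omega psi z w : open Omega -> C2_on Omega psi ->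
  Omega z ->
  is_derive z ((w, 0) : spacetime R n) psi
    (\sum_(i < n) w 0 i * pderiv (Some i) psi z).
Proof.
move=> oO psiC Oz; apply: is_derive_space => i; last first.
  by have [_ [/(_ (Some i))[]]] := psiC z Oz.
apply: filterS (open_nbhs_nbhs (conj oO Oz)) => y Oy.
by have [_ [/(_ (Some i))[]]] := psiC y Oy.
Qed.

Lemma C2_is_derive_space2 Omega psi z w k : open Omega -> C2_on Omega psi ->
  Omega z ->
  is_derive z ((w, 0) : spacetime R n) (pderiv k psi)
    (\sum_(i < n) w 0 i * pderiv (Some i) (pderiv k psi) z).
Proof.
move=> oO psiC Oz; apply: is_derive_space => i; last first.
  by have [_ [_ /(_ k (Some i))[]]] := psiC z Oz.
apply: filterS (open_nbhs_nbhs (conj oO Oz)) => y Oy.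
by have [_ [_ /(_ k (Some i))[]]] := psiC y Oy.
Qed.

Lemma hessx_sym Omega psi z : open Omega -> C2_on Omega psi -> Omega z ->
  (hessx psi z)^T = hessx psi z.
Proof.
move=> oO psiC Oz; apply/matrixP => i j; rewrite !mxE.
apply: schwarz.
- apply: filterS (open_nbhs_nbhs (conj oO Oz)) => y Oy.
  have [_ [d1 d2]] := psiC y Oy.
  split; [exact: (d1 (Some _)).1|exact: (d1 (Some _)).1
    |exact: (d2 (Some _) (Some _)).1|exact: (d2 (Some _) (Some _)).1].
- by have [_ [_ /(_ (Some j) (Some i))[]]] := psiC z Oz.
- by have [_ [_ /(_ (Some i) (Some j))[]]] := psiC z Oz.
Qed.

Definition quadform (X : 'M[R]_n) w : R :=
  \sum_(i < n) \sum_(j < n) w 0 i * w 0 j * X i j.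

(** The second derivative test is applied to [F - P], where [P] is [psi] on the line through [z] in
    the space direction [w]. Only the restriction [F] of the touching function to that line
    enters. *)
Lemma touching_test Omega psi z w (F dF : R -> R) (m : R) :
  open Omega -> C2_on Omega psi -> Omega z ->
  (\forall h \near (0 : R), is_derive h (1 : R) F (dF h)) ->
  is_derive (0 : R) (1 : R) dF m ->
  (\forall h \near (0 : R),
     F h - psi (h *: ((w, 0) : spacetime R n) + z) <= F 0 - psi z) ->
  dF 0 = \sum_(i < n) w 0 i * gradx psi z 0 i /\
  m <= quadform (hessx psi z) w.
Proof.
move=> oO psiC Oz dF1 dF2 mx; pose W : spacetime R n := (w, 0).
pose P h := psi (h *: W + z).
pose Q i h := pderiv (Some i) psi (h *: W + z).
pose dP h := \sum_(i < n) w 0 i * Q i h.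
have dP1 : \forall h \near (0 : R), is_derive h (1 : R) P (dP h).
  apply: filterS (near_line W oO Oz) => h Oh; apply: is_derive_line.
  exact: C2_is_derive_space oO psiC Oh.
have dP2 : is_derive (0 : R) (1 : R) dP (quadform (hessx psi z) w).
  have -> : dP = \sum_(i < n) (w 0 i \*: Q i).
    by apply/funext => h; rewrite fct_sumE.
  have -> : quadform (hessx psi z) w = \sum_(i < n) w 0 i *:
      (\sum_(j < n) w 0 j * pderiv (Some j) (pderiv (Some i) psi) z).
    apply: eq_bigr => i _; rewrite scaler_sumr; apply: eq_bigr => j _.
    by rewrite mxE -mulrA.
  apply: is_derive_sum => i; apply: is_deriveZ; apply: is_derive_line.
  have zE : (0 : R) *: W + z = z by rewrite scale0r add0r.
  by rewrite zE; exact: C2_is_derive_space2 oO psiC Oz.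
have P0 : P 0 = psi z by rewrite /P scale0r add0r.
have [||] := @second_derivative_test R (F - P) (dF - dP)
  (m - quadform (hessx psi z) w).
- near=> h; apply: is_deriveB; first by near: h.
  by near: h.
- by apply: filterS mx => h; rewrite -P0.
move=> /eqP; rewrite subr_eq0 => /eqP -> Hm; split; last by rewrite -subr_le0.
by apply: eq_bigr => i _; rewrite /Q scale0r add0r mxE.
Unshelve. all: by end_near. Qed.

Lemma sqnorm_ge0 w : 0 <= sqnorm w.
Proof. by apply: sumr_ge0 => i _; exact: sqr_ge0. Qed.

Lemma sqr_le_sqnorm w i : w 0 i ^+ 2 <= sqnorm w.
Proof.
rewrite /sqnorm (bigD1 i)//= lerDl.
by apply: sumr_ge0 => j _; exact: sqr_ge0.
Qed.

Lemma sqnorm_eq0 w : (sqnorm w == 0) = (w == 0).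
Proof.
apply/eqP/eqP => [w0|->]; last first.
  by apply: big1 => i _; rewrite mxE expr0n.
apply/rowP => i; rewrite mxE; apply/eqP; rewrite -sqrf_eq0 eq_le sqr_ge0 andbT.
by rewrite -w0 sqr_le_sqnorm.
Qed.

Lemma sqnorm_gt0 w : (0 < sqnorm w) = (w != 0).
Proof. by rewrite lt0r sqnorm_eq0 sqnorm_ge0 andbT. Qed.

Lemma quadform_eigenvector (X : 'M[R]_n) w a :
  w *m X = a *: w -> quadform X w = a * sqnorm w.
Proof.
move=> wX; rewrite /quadform exchange_big mulr_sumr; apply: eq_bigr => j _.
transitivity (w 0 j * (w *m X) 0 j).
  by rewrite mxE mulr_sumr; apply: eq_bigr => i _; ring.
by rewrite wX mxE; ring.
Qed.

(** A crude bound from [|w_i w_j| <= |w|^2]. It bounds the set of eigenvalues, so that its supremum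
    is an upper bound. *)
Lemma quadform_le (X : 'M[R]_n) w :
  quadform X w <= (\sum_(i < n) \sum_(j < n) `|X i j|) * sqnorm w.
Proof.
rewrite mulr_suml; apply: ler_sum => i _.
rewrite mulr_suml; apply: ler_sum => j _.
apply: (le_trans (ler_norm _)); rewrite normrM mulrC ler_wpM2l//.
have := sqr_le_sqnorm w i; have := sqr_le_sqnorm w j.
have : 0 <= (w 0 i - w 0 j) ^+ 2 by exact: sqr_ge0.
have : 0 <= (w 0 i + w 0 j) ^+ 2 by exact: sqr_ge0.
have := sqnorm_ge0 w.
move: (w 0 i) (w 0 j) (sqnorm w) => a b s.
by rewrite ler_norml => *; apply/andP; split; nra.
Qed.

(** A single eigenvector suffices: evaluating the form there puts its eigenvalue above [m], and the
    supremum is above that eigenvalue. *)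
Lemma le_largest_eigenvalue (X : 'M[R]_n) m : (0 < n)%N -> X^T = X ->
  (forall w, m * sqnorm w <= quadform X w) -> m <= largest_eigenvalue X.
Proof.
move=> n0 XT mX; have [a aX] := symmetric_eigenvalue n0 XT.
have /eigenvalueP[v /quadform_eigenvector vX v0] := aX.
apply: (@le_trans _ _ a).
  by have := mX v; rewrite vX ler_pM2r// sqnorm_gt0.
apply: ub_le_sup => //; exists (\sum_(i < n) \sum_(j < n) `|X i j|).
move=> b /= /eigenvalueP[w /quadform_eigenvector wX w0].
by have := quadform_le X w; rewrite wX ler_pM2r// sqnorm_gt0.
Qed.

End SpatialDerivatives.

(** * Derivatives of the barrier along space lines and in time *)

Section OneVariable.
Context {R : realType}.

(** On a line in space the barrier is a constant minus the exponential of a quadratic polynomial,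
    see [barrier_line]. *)
Lemma is_derive_gauss (A al be ga h : R) :
  is_derive h (1 : R) (fun h => A - expR (al + be * h + ga * h ^+ 2))
    (- ((be + 2 * ga * h) * expR (al + be * h + ga * h ^+ 2))).
Proof.
pose p : R -> R := cst al + be \*: id + ga \*: id ^+ 2.
have dp : is_derive h (1 : R) p (be + 2 * ga * h).
  by apply: is_derive_eq; rewrite add0r /GRing.scale /= expr1; ring.
have -> : (fun h => A - expR (al + be * h + ga * h ^+ 2)) = cst A - expR \o p.
  by apply/funext.
apply: is_derive_eq; by rewrite sub0r mulrC mulrN.
Qed.

Lemma is_derive_gauss2 (al be ga : R) :
  is_derive (0 : R) (1 : R)
    (fun h => - ((be + 2 * ga * h) * expR (al + be * h + ga * h ^+ 2)))
    (- ((be ^+ 2 + 2 * ga) * expR al)).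
Proof.
pose E : R -> R := fun h => 0 - expR (al + be * h + ga * h ^+ 2).
have dE : is_derive (0 : R) (1 : R) E _ := is_derive_gauss 0 al be ga 0.
have -> : (fun h => - ((be + 2 * ga * h) * expR (al + be * h + ga * h ^+ 2))) =
    (cst be + (2 * ga) \*: id) * E.
  by apply/funext => h; rewrite -mulrN -[in LHS]sub0r.
apply: is_derive_eq; rewrite /E -[(_ + _) 0]/(be + 2 * ga * 0).
rewrite expr0n /= !mulr0 !addr0 add0r -![_ *: _]/(_ * _).
ring.
Qed.

Section Barrier.
Variables a d C : R.

Definition logscale (t : R) : R := - ln (- t).

(* With [q = |x|^2]; for [a = (1 + d) / (4 (1 + eps))] this vanishes on the
   lateral boundary of the domain. *)
Definition bump_exponent (q t : R) : R :=
  a * q / - t - (1 + d) * ln (logscale t).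

(** Powers of [L = logscale t] are written as exponentials of multiples of [ln L]; the last term is
    [(C / d) L^-d]. *)
Definition profile (q t : R) : R :=
  1 - expR (bump_exponent q t) + C / d * expR (- d * ln (logscale t)).

Lemma is_derive_logscale (t : R) : t < 0 ->
  is_derive t (1 : R) logscale ((- t)^-1).
Proof.
move=> t0; have nt0 : 0 < - t by rewrite oppr_gt0.
have ? := is_derive1_ln nt0.
have -> : logscale = - (@ln R \o -%R) by apply/funext.
by apply: is_derive_eq; rewrite mulrN1 opprK.
Qed.

Lemma is_derive_ln_logscale (t : R) : t < 0 -> 0 < logscale t ->
  is_derive t (1 : R) (fun t => ln (logscale t)) ((logscale t * - t)^-1).
Proof.
move=> t0 L0; have ? := is_derive_logscale t0; have ? := is_derive1_ln L0.
have -> : (fun t => ln (logscale t)) = @ln R \o logscale by apply/funext.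
by apply: is_derive_eq; rewrite invfM.
Qed.

Lemma is_derive_profile_time (q t : R) : t < 0 -> 0 < logscale t ->
  is_derive t (1 : R) (profile q)
    (- ((a * q / (- t) ^+ 2 - (1 + d) / (logscale t * - t)) *
        expR (bump_exponent q t))
     - C / d * d / (logscale t * - t) * expR (- d * ln (logscale t))).
Proof.
move=> t0 L0; have ? := is_derive_ln_logscale t0 L0.
have nt0 : - t != 0 by rewrite oppr_eq0 lt_eqF.
set dL := (logscale t * - t)^-1.
have dV : is_derive t (1 : R) (fun t => (- t)^-1) ((- t) ^- 2).
  have [dN eN] : is_derive t (1 : R) (-%R : R -> R) (-1) := is_deriveNid t 1.
  split; first exact: (derivableV nt0 dN).
  by rewrite (deriveV nt0 dN) eN -[_ *: _]/(_ * _) mulrN1 opprK.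
have dB : is_derive t (1 : R) (bump_exponent q)
    (a * q / (- t) ^+ 2 - (1 + d) * dL).
  have -> : bump_exponent q = ((a * q) \*: (fun t => (- t)^-1)) -
     ((1 + d) \*: (fun t => ln (logscale t))) by apply/funext.
  exact: is_deriveB.
have dD : is_derive t (1 : R) (fun t => - d * ln (logscale t)) (- d * dL).
  exact: is_deriveZ.
have -> : profile q = cst 1 - expR \o bump_exponent q +
    (C / d) \*: (expR \o (fun t => - d * ln (logscale t))).
  by apply/funext.
apply: is_derive_eq; rewrite -[_ *: _]/(_ * _)/=; ring.
Qed.

End Barrier.

End OneVariable.

(** * The one-dimensional heat inequality for the barrier *)

Section BarrierInequality.
Context {R : realType}.
Variables a d : R.
Hypotheses (a0 : 0 < a) (a4 : 4 * a < 1) (d0 : 0 < d).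

(* The time correction with this constant absorbs the positive part of
   [e^(a y) (1 + d + 2 a - a (1 - 4 a) y)], [y = |x|^2 / -t >= 0], whose
   polynomial factor vanishes at [y = K]. *)
Definition correction : R :=
  let K := (1 + d + 2 * a) / (a * (1 - 4 * a)) in
  (1 + d + 2 * a) * expR (a * K).

Lemma correction_gt0 : 0 < correction.
Proof.
by rewrite mulr_gt0 ?expR_gt0// -addrA addr_gt0// addr_gt0// mulr_gt0.
Qed.

(** Up to [K] the exponential is largest at [K] and the polynomial factor at [0]; beyond [K] the
    polynomial factor is nonpositive. *)
Lemma correction_bound (y : R) : 0 <= y ->
  expR (a * y) * (1 + d + 2 * a - a * (1 - 4 * a) * y) <= correction.
Proof.
move=> y0; rewrite /correction; set K := _ / _.
have b0 : 0 < a * (1 - 4 * a) by rewrite mulr_gt0// subr_gt0.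
have num0 : 0 < 1 + d + 2 * a by rewrite -addrA addr_gt0// addr_gt0// mulr_gt0.
have [yK|Ky] := lerP y K.
  rewrite mulrC; apply: ler_pM => //.
  - by rewrite subr_ge0 mulrC -ler_pdivlMr.
  - by rewrite lerBlDr lerDl mulr_ge0// ?ltW.
  - by rewrite ler_expR ler_wpM2l// ltW.
apply: (@le_trans _ _ 0); last by rewrite ltW// mulr_gt0// expR_gt0.
rewrite mulr_ge0_le0 ?expR_ge0// subr_le0 [leRHS]mulrC -ler_pdivrMr//.
exact: ltW Ky.
Qed.

(** The left side is the time derivative of [profile] with [C = correction], the right side its
    second derivative in the radius [|x|]. Once [L^-(1+d) / -t] is factored out, [1 <= L] bounds
    [(1 + d) / L] by [1 + d], and [correction_bound] at [y = q / -t] concludes. *)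
Lemma profile_heat_le (q t : R) : 0 <= q -> t < 0 -> 1 <= logscale t ->
  - ((a * q / (- t) ^+ 2 - (1 + d) / (logscale t * - t)) *
      expR (bump_exponent a d q t))
  - correction / d * d / (logscale t * - t) * expR (- d * ln (logscale t))
  <= - ((4 * a ^+ 2 * q / (- t) ^+ 2 + 2 * a / - t) *
        expR (bump_exponent a d q t)).
Proof.
move=> q0 t0 L1; set L := logscale t in L1 *; set l := ln L.
have L0 : 0 < L by rewrite (lt_le_trans _ L1).
have s0 : 0 < - t by rewrite oppr_gt0.
pose y := q / - t; have y0 : 0 <= y by rewrite divr_ge0// ltW.
have -> : bump_exponent a d q t = a * y - (1 + d) * l.
  by rewrite /bump_exponent -mulrA.
pose E := expR (- ((1 + d) * l)).
have E0 : 0 < E by exact: expR_gt0.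
have -> : expR (- d * l) = L * E.
  rewrite -{1}(lnK (x := L)) ?posrE// -expRD; congr expR; rewrite -/l; ring.
rewrite expRD -/E; have := correction_bound y0.
have := expR_gt0 (a * y); move: (expR (a * y)) => e e0 Hc.
rewrite -subr_ge0.
have -> : q = y * - t by rewrite /y divfK// gt_eqF.
set c := correction in Hc *.
suff : 0 <= E / - t * (c - e * ((1 + d) / L + 2 * a - a * (1 - 4 * a) * y)).
  congr (0 <= _); field; apply/and3P; split;
    [by rewrite lt_eqF|exact: lt0r_neq0 L0|by rewrite gt_eqF].
rewrite mulr_ge0//; first by rewrite divr_ge0 ?ltW.
rewrite subr_ge0; apply: le_trans Hc.
rewrite ler_pM2l// !lerD2r ler_pdivrMr// ler_peMr// addr_ge0//; exact: ltW.
Qed.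

End BarrierInequality.

(** * Test functions touching the barrier from above *)

Section BarrierTouching.
Context {R : realType} {n : nat}.
Implicit Types (Omega : set (spacetime R n)) (psi : spacetime R n -> R).
Implicit Types (z : spacetime R n) (w x : 'rV[R]_n).

Definition dotr x w : R := \sum_(i < n) x 0 i * w 0 i.

Lemma sqnorm_line x w (h : R) :
  sqnorm (h *: w + x) = sqnorm x + 2 * h * dotr x w + h ^+ 2 * sqnorm w.
Proof.
rewrite /sqnorm /dotr !mulr_sumr -!big_split; apply: eq_bigr => i _ /=.
by rewrite !mxE; ring.
Qed.

Lemma dotr_delta x i : dotr x (delta_mx 0 i) = x 0 i.
Proof.
rewrite /dotr (bigD1 i)//= big1 ?addr0; last first.
  by move=> j ji; rewrite mxE (negbTE ji) andbF mulr0.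
by rewrite mxE !eqxx mulr1.
Qed.

Lemma dotr_scaler x k : dotr x (k *: x) = k * sqnorm x.
Proof. by rewrite mulr_sumr; apply: eq_bigr => i _; rewrite !mxE; ring. Qed.

Lemma sqnormZ x k : sqnorm (k *: x) = k ^+ 2 * sqnorm x.
Proof. by rewrite mulr_sumr; apply: eq_bigr => i _; rewrite !mxE; ring. Qed.

Variables a d : R.
Hypotheses (a0 : 0 < a) (a4 : 4 * a < 1) (d0 : 0 < d).

Definition barrier z : R := profile a d (correction a d) (sqnorm z.1) z.2.

Let bump z := expR (bump_exponent a d (sqnorm z.1) z.2).

Lemma barrier_line z w (h : R) :
  barrier (h *: ((w, 0) : spacetime R n) + z) =
  1 + correction a d / d * expR (- d * ln (logscale z.2)) -
  expR (bump_exponent a d (sqnorm z.1) z.2 +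
        2 * a * dotr z.1 w / - z.2 * h + a * sqnorm w / - z.2 * h ^+ 2).
Proof.
have -> : h *: ((w, 0) : spacetime R n) + z = (h *: w + z.1, z.2).
  by case: z => x t; congr (_, _); rewrite /= scaler0 add0r.
rewrite /barrier /profile /= sqnorm_line addrAC; congr (_ - expR _).
by rewrite /bump_exponent; ring.
Qed.

(** The comparison involves only times up to [z.2]. Space lines through [z] stay at time [z.2] and
    give the gradient and the Hessian bound; in time only the left-hand test is available, and it
    yields the needed inequality, time derivative of [psi] at most that of the barrier. *)
Lemma barrier_touching Omega psi z : open Omega -> C2_on Omega psi ->
  Omega z -> z.2 < 0 -> 1 <= logscale z.2 ->
  (forall y, Omega y -> y.2 <= z.2 -> barrier y - psi y <= barrier z - psi z) ->
  [/\ gradx psi z = (- (2 * a / - z.2 * bump z)) *: z.1,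
      (forall w, - ((4 * a ^+ 2 * dotr z.1 w ^+ 2 / (- z.2) ^+ 2 +
                     2 * a * sqnorm w / - z.2) * bump z)
                 <= quadform (hessx psi z) w) &
      time_deriv psi z <=
      - ((4 * a ^+ 2 * sqnorm z.1 / (- z.2) ^+ 2 + 2 * a / - z.2) * bump z)].
Proof.
move=> oO psiC Oz z20 L1 mx.
have tst w : - (2 * a * dotr z.1 w / - z.2 * bump z) =
      \sum_(i < n) w 0 i * gradx psi z 0 i /\
    - ((4 * a ^+ 2 * dotr z.1 w ^+ 2 / (- z.2) ^+ 2 +
         2 * a * sqnorm w / - z.2) * bump z) <= quadform (hessx psi z) w.
  pose be := 2 * a * dotr z.1 w / - z.2; pose ga := a * sqnorm w / - z.2.
  pose al := bump_exponent a d (sqnorm z.1) z.2.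
  pose A := 1 + correction a d / d * expR (- d * ln (logscale z.2)).
  have dF : \forall h \near (0 : R), is_derive h (1 : R)
      (fun h => A - expR (al + be * h + ga * h ^+ 2))
      (- ((be + 2 * ga * h) * expR (al + be * h + ga * h ^+ 2))).
    by apply: (@filterE _ (nbhs (0 : R))) => h; exact: is_derive_gauss.
  have [|E1 E2] := touching_test oO psiC Oz dF (is_derive_gauss2 al be ga)
    (w := w).
  apply: filterS (near_line ((w, 0) : spacetime R n) oO Oz) => h Oh.
    rewrite -barrier_line mulr0 addr0 expr0n mulr0 addr0.
    rewrite [X in _ <= X - _](_ : _ = barrier z); last first.
      by rewrite /barrier /profile addrAC.
    by apply: mx => //=; rewrite scaler0 add0r.
  rewrite -E1 !mulr0 !addr0 expr0n /= !mulr0 !addr0; split=> //.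
  apply: le_trans E2; rewrite le_eqVlt; apply/orP; left; apply/eqP.
  congr (- (_ * _)); rewrite /be /ga; field; by rewrite lt_eqF.
split; last 1 first.
- have L0 : 0 < logscale z.2 by rewrite (lt_le_trans _ L1).
  apply: le_trans (profile_heat_le a0 a4 d0 (sqnorm_ge0 _) z20 L1).
  pose q := sqnorm z.1; pose e : spacetime R n := (0, 1).
  have dpsi : is_derive (0 : R) (1 : R) (fun h => psi (h *: e + z))
      (time_deriv psi z).
    apply: is_derive_line; rewrite scale0r add0r; apply: derivableP.
    by have [_ [/(_ None)[]]] := psiC z Oz.
  have dprof := is_derive_profile_time a d (correction a d) q z20 L0.
  set m := (X in is_derive _ _ _ X) in dprof.
  have dbar : is_derive (0 : R) (1 : R) (fun h => barrier (h *: e + z)) m.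
    have -> : (fun h => barrier (h *: e + z)) =
        (fun h : R => profile a d (correction a d) q (h *: (1 : R) + z.2)).
      by apply/funext => h; rewrite /barrier /= scaler0 add0r.
    by apply: is_derive_line; rewrite scale0r add0r.
  rewrite -subr_ge0.
  apply: (is_derive_left_max_ge0 (is_deriveB dbar dpsi)).
  apply: filterS (near_line e oO Oz) => h Oh h0.
  suff : barrier (h *: e + z) - psi (h *: e + z) <=
    barrier (0 *: e + z) - psi (0 *: e + z) by [].
  rewrite scale0r add0r; apply: mx => //=.
  by rewrite [h *: _]mulr1 gerDr ltW.
- apply/rowP => i; have [+ _] := tst (delta_mx 0 i).
  rewrite dotr_delta (bigD1 i)//= big1 ?addr0; last first.
    by move=> j ji; rewrite mxE (negbTE ji) andbF mul0r.
  rewrite !mxE !eqxx mul1r => <-; ring.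
- by move=> w; have [_] := tst w.
Qed.

End BarrierTouching.

Lemma barrier_viscosity_test {R : realType} {n : nat} (a d : R)
    (Omega : set (spacetime R n)) psi z :
  (0 < n)%N -> 0 < a -> 4 * a < 1 -> 0 < d ->
  open Omega -> C2_on Omega psi -> Omega z -> z.2 < 0 -> 1 <= logscale z.2 ->
  (forall y, Omega y -> y.2 <= z.2 ->
     barrier a d y - psi y <= barrier a d z - psi z) ->
  (gradx psi z != 0 -> time_deriv psi z - norm_infty_laplacian psi z <= 0) /\
  (gradx psi z = 0 ->
     time_deriv psi z - largest_eigenvalue (hessx psi z) <= 0).
Proof.
move=> n0 a0 a4 d0 oO psiC Oz z20 L1 mx.
have [Dpsi Hpsi psit] := barrier_touching a0 a4 d0 oO psiC Oz z20 L1 mx.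
have s0 : 0 < - z.2 by rewrite oppr_gt0.
set G := expR _ in Dpsi psit Hpsi.
have G0 : 0 < G by exact: expR_gt0.
set k := - _ in Dpsi; have k0 : k != 0.
  by rewrite oppr_eq0 gt_eqF// mulr_gt0// divr_gt0// mulr_gt0.
split=> [Dn0|D0].
  rewrite subr_le0; apply: (le_trans psit).
  rewrite /norm_infty_laplacian ler_pdivlMl ?sqnorm_gt0//.
  (* The gradient is a multiple of [x], so in its direction the Hessian bound is [|D psi|^2] times
     the bound on the time derivative. *)
  apply: le_trans (Hpsi (gradx psi z)); rewrite Dpsi dotr_scaler sqnormZ.
  by rewrite le_eqVlt; apply/orP; left; apply/eqP; field; rewrite lt_eqF.
(* As [k] is nonzero, the gradient vanishes only on the axis, where the Hessian bound is the same in
   all directions. *)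
have x0 : z.1 = 0.
  by apply/eqP; move: D0; rewrite Dpsi => /eqP; rewrite scaler_eq0 (negbTE k0).
rewrite subr_le0; apply: (le_trans psit); apply: le_largest_eigenvalue => //.
  exact: hessx_sym oO psiC Oz.
move=> w; apply: le_trans (Hpsi w).
have -> : dotr z.1 w = 0 by rewrite x0; apply: big1 => i _; rewrite mxE mul0r.
have -> : sqnorm z.1 = 0 by apply/eqP; rewrite sqnorm_eq0 x0.
by rewrite le_eqVlt; apply/orP; left; apply/eqP; field; rewrite lt_eqF.
Qed.

(** * Continuity of the barrier *)

Section Domain.
Context {R : realType} {n : nat}.
Implicit Types (z : spacetime R n).

Lemma continuous_time_comp (g : R -> R) z :
  {for z.2, continuous g} ->
  {for z, continuous (fun y : spacetime R n => g y.2)}.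
Proof.
have c2 : (fun y : spacetime R n => y.2) @ z --> z.2 by exact: cvg_snd.
by move=> cg; exact: cvg_comp c2 cg.
Qed.

Lemma continuous_sqnorm z :
  {for z, continuous (fun y : spacetime R n => sqnorm y.1)}.
Proof.
apply: cvg_big => [|i _]; first exact: add_continuous.
have ci : {for z, continuous (fun y : spacetime R n => y.1 0 i)}.
  have c1 : (fun y : spacetime R n => y.1) @ z --> z.1 by exact: cvg_fst.
  exact: cvg_comp c1 (@coord_continuous R 1 n 0 i z.1).
exact: (cvgM ci ci).
Qed.

Lemma continuous_ln_logscale z : z.2 < 0 -> 0 < logscale z.2 ->
  {for z, continuous (fun y : spacetime R n => ln (logscale y.2))}.
Proof.
move=> z20 L0; apply: (continuous_time_comp (g := fun t => ln (logscale t))).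
have [dL _] := is_derive_ln_logscale z20 L0.
exact/differentiable_continuous/derivable1_diffP.
Qed.

Lemma continuous_barrier (a d : R) z : z.2 < 0 -> 0 < logscale z.2 ->
  {for z, continuous (@barrier R n a d)}.
Proof.
move=> z20 L0; have cl := continuous_ln_logscale z20 L0.
have cV : {for z, continuous (fun y : spacetime R n => (- y.2)^-1)}.
  apply: cvgV; first by rewrite oppr_eq0 lt_eqF.
  by apply: cvgN; exact: cvg_snd.
have cexp (g : spacetime R n -> R) : {for z, continuous g} ->
    {for z, continuous (fun y => expR (g y))}.
  by move=> cg; apply: continuous_comp => //; exact: continuous_expR.
rewrite /barrier /profile; apply: cvgD.
  apply: cvgB; first exact: cvg_cst.
  apply: cexp; apply: cvgB.
    by apply: cvgM cV; apply: cvgM; [exact: cvg_cst|exact: continuous_sqnorm].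
  by apply: cvgM cl; exact: cvg_cst.
apply: cvgM; first exact: cvg_cst.
by apply: cexp; apply: cvgM cl; exact: cvg_cst.
Qed.

End Domain.

(** * The domain, its closure, and its defining function *)

Section Petrovsky.
Context {R : realType} {n : nat}.
Implicit Types (z : spacetime R n) (t : R).
Variables eps c : R.
Hypotheses (e0 : 0 < eps) (c0 : 0 < c) (c1 : c < 1).
Notation Omega := (@petrovsky_domain R n eps c).

(** Defining function of the lateral boundary without absolute values: for [- 1 < t < 0], [|log|t||]
    is [logscale t]. *)
Definition gap z : R :=
  sqnorm z.1 - 4 * (1 + eps) * - z.2 * ln (logscale z.2).

Lemma logscale_gt0 t : - 1 < t < 0 -> 0 < logscale t.
Proof.
by move=> /andP[t1 t0]; rewrite oppr_gt0 ln_lt0// oppr_gt0 t0 ltrNl.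
Qed.

Lemma slab t : - c < t < 0 -> - 1 < t < 0.
Proof. by move=> /andP[ct ->]; rewrite andbT (lt_trans _ ct)// ltrN2. Qed.

Lemma petrovskyP z : Omega z <-> - c < z.2 < 0 /\ gap z < 0.
Proof.
have absE : - c < z.2 < 0 -> `| ln `|z.2| | = logscale z.2.
  move=> zc; have L0 := logscale_gt0 (slab zc); have /andP[_ z0] := zc.
  by rewrite (ltr0_norm z0) ltr0_norm// -oppr_gt0.
have coefE : - 4 * (1 + eps) * z.2 = 4 * (1 + eps) * - z.2 by ring.
rewrite /petrovsky_domain /gap subr_lt0 /= coefE.
by split=> -[zc]; rewrite absE.
Qed.

(** If [L < 1] then [ln L < 0] and [gap] is positive. So the domain contains only times with
    [L >= 1], however close [c] is to [1]. *)
Lemma gap_le0_logscale z : - 1 < z.2 < 0 -> gap z <= 0 -> 1 <= logscale z.2.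
Proof.
move=> zc; rewrite /gap subr_le0 => zg; rewrite leNgt; apply/negP => L1.
have L0 := logscale_gt0 zc; have /andP[_ z0] := zc.
have l0 : ln (logscale z.2) < 0 by rewrite ln_lt0// L0.
have := le_trans (sqnorm_ge0 _) zg.
rewrite leNgt pmulr_rlt0 ?l0//.
by rewrite !mulr_gt0 ?oppr_gt0// addr_gt0.
Qed.

Lemma continuous_gap z : - 1 < z.2 < 0 -> {for z, continuous gap}.
Proof.
move=> zc; have L0 := logscale_gt0 zc; have /andP[_ z0] := zc.
apply: cvgB; first exact: continuous_sqnorm.
apply: cvgM; last exact: continuous_ln_logscale.
by apply: cvgM; [exact: cvg_cst|apply: cvgN; exact: cvg_snd].
Qed.

Lemma near_time z (P : set R) : nbhs z.2 P -> \forall y \near z, P y.2.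
Proof.
have c2 : (fun y : spacetime R n => y.2) @ z --> z.2 by exact: cvg_snd.
by move=> /c2.
Qed.

Lemma open_petrovsky : open Omega.
Proof.
rewrite openE => z /petrovskyP[zc zg].
have /andP[zc1 z0] := zc.
have near1 := near_time (lt_nbhsr zc1).
have near2 := near_time (lt_nbhsl z0).
have near3 : \forall y \near z, gap y < 0.
  by exact: (cvgr_lt _ (continuous_gap (slab zc)) _ zg).
suff : nbhs z Omega by [].
apply: filterS (filterI near1 (filterI near2 near3)) => y [y1 [y2 y3]].
by apply/petrovskyP; split=> //; rewrite y1.
Qed.

Lemma closure_petrovsky z : closure Omega z ->
  - c <= z.2 <= 0 /\ (z.2 < 0 -> gap z <= 0).
Proof.
move=> cz.
have zc : - c <= z.2.
  rewrite leNgt; apply/negP => zc.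
  have [y [/petrovskyP[/andP[yc _] _] /=]] := cz _ (near_time (lt_nbhsl zc)).
  by move=> /(lt_trans yc); rewrite ltxx.
have z0 : z.2 <= 0.
  rewrite leNgt; apply/negP => z0.
  have [y [/petrovskyP[/andP[_ y0] _] /=]] := cz _ (near_time (lt_nbhsr z0)).
  by move=> /(lt_trans y0); rewrite ltxx.
split; first by rewrite zc.
move=> z1; rewrite leNgt; apply/negP => zg.
have zs : - 1 < z.2 < 0 by rewrite z1 andbT (lt_le_trans _ zc)// ltrN2.
have near_gap : \forall y \near z, 0 < gap y.
  by exact: (cvgr_gt _ (continuous_gap zs) _ zg).
have [y [/petrovskyP[_ yg] /=]] := cz _ near_gap.
by move=> /(lt_trans yg); rewrite ltxx.
Qed.

(** * Truncated barriers and their membership in the lower class *)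

Definition truncated_barrier (a d tau : R) z : \bar R :=
  if z.2 <= - tau then (barrier a d z)%:E else -oo%E.

(** This is upper semicontinuity, also across the cut: the finite value is kept at time [- tau]
    itself, and the jump to [-oo] only lowers the function. *)
Lemma truncated_barrier_lt (a d tau b : R) z :
  0 < tau -> (z.2 <= - tau -> barrier a d z < b) ->
  (z.2 <= - tau -> 0 < logscale z.2) ->
  \forall y \near z, (truncated_barrier a d tau y < b%:E)%E.
Proof.
move=> tau0 zb L0; have [zt|zt] := leP z.2 (- tau).
  have z0 : z.2 < 0 by rewrite (le_lt_trans zt)// oppr_lt0.
  have near_b : \forall y \near z, barrier a d y < b.
    exact: (cvgr_lt _ (continuous_barrier z0 (L0 zt)) _ (zb zt)).
  apply: filterS near_b => y yb; rewrite /truncated_barrier.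
  by case: ifP => _; rewrite ?lte_fin ?ltNyr.
apply: filterS (near_time (lt_nbhsr zt)) => y yt.
by rewrite /truncated_barrier leNgt yt /= ltNyr.
Qed.

Lemma truncated_barrier_subsolution (a d tau : R) :
  (0 < n)%N -> 0 < a -> 4 * a < 1 -> 0 < d -> 0 < tau ->
  Omega (0, - tau) -> subsolution Omega (truncated_barrier a d tau).
Proof.
move=> n0 a0 a4 d0 tau0 Otau; split.
- by move=> z _; rewrite /truncated_barrier; case: ifP.
- move=> z /petrovskyP[zc _] b vb; apply: cvg_within.
  apply: truncated_barrier_lt => // zt; last exact: logscale_gt0 (slab zc).
  by move: vb; rewrite /truncated_barrier zt lte_fin.
move=> psi z psiC [Oz mx].
have /petrovskyP[zc zg] := Oz; have zs := slab zc; have /andP[_ z0] := zc.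
(* A maximum cannot lie where the function is [-oo], because its value at [(0, - tau)] is finite. *)
have zt : z.2 <= - tau.
  rewrite leNgt; apply/negP => zt; have := mx _ Otau.
  by rewrite /truncated_barrier /= lexx (lt_geF zt) addNye leeNy_eq.
apply: (barrier_viscosity_test n0 a0 a4 d0 open_petrovsky psiC Oz z0).
  exact: gap_le0_logscale zs (ltW zg).
move=> y Oy yz; have := mx y Oy.
by rewrite /truncated_barrier (le_trans yz zt) zt -!EFinB lee_fin.
Qed.

Lemma limf_esup_le (v : spacetime R n -> \bar R) z (A : set (spacetime R n)) b :
  (forall b', b < b' -> \forall y \near within A (nbhs z), (v y <= b'%:E)%E) ->
  (limf_esup v (within A (nbhs z)) <= b%:E)%E.
Proof.
move=> vb; apply/lee_addgt0Pr => e e_gt0.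
have /vb vbe : b < b + e by rewrite ltrDl.
apply: (@le_trans _ _ (ereal_sup (v @` [set y | (v y <= (b + e)%:E)%E]))).
  by apply: ereal_inf_lbound; exists [set y | (v y <= (b + e)%:E)%E].
by apply: ge_ereal_sup => _ [y /= yb <-].
Qed.

Lemma barrier_le (a d : R) z : 0 < a -> 0 < d -> 1 <= logscale z.2 ->
  barrier a d z <= 1 + correction a d / d.
Proof.
move=> a0 d0 L1; apply: lerD; first by rewrite gerBl expR_ge0.
have C0 := correction_gt0 a0 d0.
rewrite ler_piMr//; first by rewrite ltW// divr_gt0.
rewrite -[leRHS]expR0 ler_expR.
by rewrite mulNr oppr_le0 mulr_ge0 ?ln_ge0// ltW.
Qed.

(** By the choice of [a], [0 <= gap z] says that the bump exponent is nonnegative, so the bump is at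
    least [1] and absorbs the constant [1]. *)
Lemma barrier_lateral_le (d : R) z : - 1 < z.2 < 0 -> 0 <= gap z -> 0 < d ->
  let a := (1 + d) / (4 * (1 + eps)) in
  barrier a d z <= correction a d / d * expR (- d * ln (logscale z.2)).
Proof.
move=> /andP[_ z0] zg d0; set a := _ / _; cbv zeta.
rewrite /barrier /profile gerDr subr_le0 -expR0.
have s0 : 0 < - z.2 by rewrite oppr_gt0.
have e4 : 0 < 4 * (1 + eps) by rewrite mulr_gt0// addr_gt0.
have a0 : 0 < a by rewrite divr_gt0// addr_gt0.
rewrite ler_expR /bump_exponent subr_ge0 ler_pdivlMr//.
have -> : 1 + d = a * (4 * (1 + eps)) by rewrite divfK// gt_eqF.
move: zg; rewrite /gap subr_ge0 => zg.
have -> : a * (4 * (1 + eps)) * ln (logscale z.2) * - z.2 =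
    a * (4 * (1 + eps) * - z.2 * ln (logscale z.2)) by ring.
by rewrite ler_pM2l.
Qed.

(** After [- tau] the function is [-oo]. At times up to [- s0] the data exceed the global bound of
    the barrier because [M] is large. In between the boundary point is lateral and the correction is
    at most [1/2]. Neither [M] nor [s0] depends on [tau], so one datum serves all truncations. *)
Lemma truncated_barrier_lower_class (d tau M s0 : R) :
  let a := (1 + d) / (4 * (1 + eps)) in
  (0 < n)%N -> 0 < d -> d < eps -> 0 < tau -> Omega (0, - tau) ->
  0 < M -> s0 <= c -> 1 + correction a d / d <= M * s0 ->
  (forall t, - s0 < t < 0 ->
     correction a d / d * expR (- d * ln (logscale t)) <= 2^-1) ->
  lower_class Omega (fun z => 2^-1 - M * z.2) (truncated_barrier a d tau).
Proof.
move=> a n0 d0 de tau0 Otau M0 s0c Ms0 late.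
have e4 : 0 < 4 * (1 + eps) by rewrite mulr_gt0// addr_gt0.
have a0 : 0 < a by rewrite divr_gt0// addr_gt0.
have a4 : 4 * a < 1.
  by rewrite mulrA ltr_pdivrMr// mul1r ltr_pM2l// ltrD2l.
split; first exact: truncated_barrier_subsolution.
move=> z [cz zO]; have [/andP[zc _] zg] := closure_petrovsky cz.
apply: limf_esup_le => b fb; apply: cvg_within.
have zs : z.2 <= - tau -> - 1 < z.2 < 0.
  move=> zt; rewrite (lt_le_trans _ zc) ?ltrN2//=.
  by rewrite (le_lt_trans zt)// oppr_lt0.
suff zb : z.2 <= - tau -> barrier a d z < b.
  have L0 zt := logscale_gt0 (zs zt).
  by apply: filterS (truncated_barrier_lt tau0 zb L0) => y; exact: ltW.
move=> /zs zs'; apply: le_lt_trans fb; have /andP[_ z0] := zs'.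
have Mz : 0 < M * - z.2 by rewrite mulr_gt0// oppr_gt0.
rewrite -mulrN; have [zs0|zs0] := leP z.2 (- s0).
  apply: (le_trans (barrier_le a0 d0 (gap_le0_logscale zs' (zg z0)))).
  apply: (le_trans Ms0); rewrite -[leLHS]add0r lerD// ler_pM2l//.
  by rewrite lerNr.
(* Since [- c <= - s0 < z.2 < 0], a negative [gap] would make [z] an interior point. *)
have gap0 : 0 <= gap z.
  rewrite leNgt; apply/negP => gap0; apply: zO.
  apply: open_nbhs_nbhs; split; first exact: open_petrovsky.
  by apply/petrovskyP; split=> //; rewrite z0 andbT (le_lt_trans _ zs0)// lerN2.
apply: (le_trans (barrier_lateral_le zs' gap0 d0)).
apply: (@le_trans _ _ 2^-1); last by rewrite lerDl ltW.
by apply: late; rewrite zs0.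
Qed.

(** The value [4] serves the final estimate: on the axis the bump is [L^-(1+d)], at most [1/4] once
    [L >= 4]. *)
Lemma petrovsky_axis (tau : R) : 0 < tau -> tau < c -> tau <= expR (- 4) ->
  Omega (0, - tau) /\ 4 <= logscale (- tau).
Proof.
move=> tau0 tauc tau4.
have L4 : 4 <= logscale (- tau).
  by rewrite /logscale opprK lerNr -[leRHS]expRK ler_ln ?posrE ?expR_gt0.
split=> //; apply/petrovskyP; rewrite /gap /= oppr_lt0 ltrN2 tauc tau0.
split=> //; rewrite subr_lt0 opprK.
have -> : sqnorm (0 : 'rV[R]_n) = 0 by apply/eqP; rewrite sqnorm_eq0.
rewrite !mulr_gt0 ?ln_gt0 ?addr_gt0//.
by rewrite (lt_le_trans _ L4)// ltr1n.
Qed.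

Lemma petrovsky_axis_near (P : set (spacetime R n)) :
  nbhs ((0, 0) : spacetime R n) P ->
  exists tau : R, [/\ 0 < tau, Omega (0, - tau), 4 <= logscale (- tau) &
                     P (0, - tau)].
Proof.
move=> /near_norm[e e_gt0 eP].
have /near_norm[k k0 kP] :=
  near0_mul_lt `|((0, - 1) : spacetime R n)| e_gt0.
(* The three bounds keep the point above the bottom, inside the neighbourhood, and at [L >= 4];
   halving makes the inequalities strict. *)
pose m := Num.min (Num.min c k) (expR (- 4)); pose tau := m / 2.
have m0 : 0 < m by rewrite !lt_min c0 k0 expR_gt0.
have tau0 : 0 < tau by rewrite divr_gt0.
have : tau < m by rewrite /tau ltr_pdivrMr// ltr_pMr// ltr1n.
rewrite !lt_min -andbA => /and3P[tauc tauk /ltW tau4].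
have [Otau L4] := petrovsky_axis tau0 tauc tau4.
exists tau; split=> //.
have := kP tau; rewrite addr0 {1}gtr0_norm// => /(_ tauk).
rewrite -normrZ => /eP.
have -> // : tau *: ((0, - 1) : spacetime R n) + (0, 0) = (0, - tau).
by congr (_, _); rewrite /= addr0 ?scaler0// [_ *: _]mulrN1.
Qed.

End Petrovsky.

(** * Irregularity of the origin *)

Theorem theorem1p4 (R : realType) (n : nat) (eps c : R) :
  (0 < n)%N -> 0 < eps -> 0 < c -> c < 1 ->
  let Omega := @petrovsky_domain R n eps c in
  boundary Omega (0, 0) /\ ~ regular_boundary_point Omega (0, 0).
Proof.
move=> n0 e0 c0 c1 Omega; split.
  (* Points of the axis tend to the origin, which is itself outside the domain because its time is
     [0]. *)
  split=> [P /(petrovsky_axis_near e0 c0 c1)[tau [_ Otau _ Ptau]]|].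
    by exists (0, - tau).
  move=> /interior_subset /(petrovskyP eps c1) [] /=.
  by rewrite ltxx andbF.
(* Here [d > 0] makes [L^-d] tend to [0], and [d < eps] gives [4 a < 1]. *)
move=> [_ reg]; pose d := eps / 2; pose a := (1 + d) / (4 * (1 + eps)).
have d0 : 0 < d by rewrite divr_gt0.
have de : d < eps by rewrite /d ltr_pdivrMr// ltr_pMr// ltr1n.
have a0 : 0 < a by rewrite divr_gt0 ?mulr_gt0 ?addr_gt0.
pose C := correction a d / d.
have C0 : 0 < C by rewrite divr_gt0// correction_gt0.
have C2 : 0 < 2 * C by exact: mulr_gt0.
(* If [- t <= expR (- expR q)] then [L >= expR q], hence [L^-d <= expR (- d * q) = 1 / (2 C)] and
   the correction is at most [1/2]. *)
pose q := ln (2 * C) / d; pose s0 := Num.min c (expR (- expR q)).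
have s00 : 0 < s0 by rewrite lt_min c0 expR_gt0.
have s0c : s0 <= c by rewrite ge_min lexx.
have late t : - s0 < t < 0 -> C * expR (- d * ln (logscale t)) <= 2^-1.
  move=> /andP[ts t0]; have nt0 : 0 < - t by rewrite oppr_gt0.
  have ts' : - t <= expR (- expR q).
    apply: (@le_trans _ _ s0); first by rewrite lerNl ltW.
    by rewrite ge_min lexx orbT.
  have Lq : expR q <= logscale t.
    by rewrite /logscale lerNr -[leRHS]expRK ler_ln ?posrE ?expR_gt0//.
  have lq : q <= ln (logscale t).
    by rewrite -[leLHS]expRK ler_ln// ?posrE ?(lt_le_trans _ Lq) ?expR_gt0.
  have : expR (- d * ln (logscale t)) <= (2 * C)^-1.
    rewrite -[leRHS]lnK ?posrE ?invr_gt0//.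
    by rewrite ler_expR lnV ?posrE// mulNr lerN2 [leRHS]mulrC -ler_pdivrMr//.
  rewrite -(ler_pM2l C0) => /le_trans; apply.
  by rewrite invfM mulrCA divff ?mulr1// gt_eqF.
pose M := (1 + C) / s0.
have M0 : 0 < M by rewrite divr_gt0// addr_gt0.
have Ms0 : 1 + C <= M * s0 by rewrite divfK// gt_eqF.
pose f (z : spacetime R n) := 2^-1 - M * z.2.
have cf : {within boundary Omega, continuous f}.
  apply: continuous_subspaceT => z; apply: cvgB; first exact: cvg_cst.
  by apply: cvgM; [exact: cvg_cst|exact: cvg_snd].
have f0 : f (0, 0) = 2^-1 by rewrite /f /= mulr0 subr0.
(* The threshold [3/4] lies above the datum [1/2] at the origin and is reached by the barrier on the
   axis, where it is at least [1 - 1/4]. *)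
have perron_lt : \forall z \near within Omega (nbhs ((0, 0) : spacetime R n)),
    (lower_perron Omega f z < (3 / 4)%:E)%E.
  have := reg f cf; rewrite f0 => /(_ [set x | (x < (3 / 4)%:E)%E]); apply.
  apply: open_nbhs_nbhs; split; first exact: open_ereal_lt_ereal.
  by rewrite /= lte_fin; lra.
have [tau [tau0 Otau L4 /(_ Otau)]] := petrovsky_axis_near e0 c0 c1 perron_lt.
apply/negP; rewrite -leNgt.
apply: (@le_trans _ _ (truncated_barrier a d tau (0, - tau))); last first.
  apply: ereal_sup_ubound; exists (truncated_barrier a d tau) => //.
  exact: (truncated_barrier_lower_class e0 c1 n0 d0 de tau0 Otau M0 s0c Ms0
    late).
have L0 : 0 < logscale (- tau) by rewrite (lt_le_trans _ L4).
rewrite /truncated_barrier /= lexx lee_fin /barrier /profile /=.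
have -> : sqnorm (0 : 'rV[R]_n) = 0 by apply/eqP; rewrite sqnorm_eq0.
rewrite /bump_exponent mulr0 mul0r sub0r.
(* Because [ln L >= 0], [L^-(1+d) <= L^-1 <= 1/4]. *)
have : expR (- ((1 + d) * ln (logscale (- tau)))) <= 4^-1.
  apply: (@le_trans _ _ (expR (- ln (logscale (- tau))))).
    have l0 : 0 <= ln (logscale (- tau)).
      by rewrite ln_ge0// (le_trans _ L4)// ler1n.
    by rewrite ler_expR lerN2 ler_peMl// lerDl ltW.
  by rewrite expRN lnK ?posrE// lef_pV2 ?posrE.
have : 0 <= C * expR (- d * ln (logscale (- tau))).
  by rewrite mulr_ge0 ?expR_ge0// ltW.
rewrite /C; lra.
Qed.
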